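(* Let $(L,\leqslant)$ be an infinite linearly ordered set. For every natural number $n$, every congruence on the semigroup $\mathscr{OI}_n(L)$ of partial order isomorphisms of $L$ of rank at most $n$ is a Rees congruence.
   Context: Natural numbers are positive integers. A partial order isomorphism of a linearly ordered set $(L,\leqslant)$ is an injective partial map $\alpha\colon L\rightharpoonup L$ with domain $\operatorname{dom}\alpha$ and range $\operatorname{ran}\alpha$ such that for all $x_1,x_2\in\operatorname{dom}\alpha$, $x_1\leqslant x_2$ implies $(x_1)\alpha\leqslant(x_2)\alpha$ (the empty partial map $\boldsymbol{0}$ is allowed). Maps are written on the right and composed from left to right: $(x)(\alpha\beta)=((x)\alpha)\beta$, with $\operatorname{dom}(\alpha\beta)=\{y\in\operatorname{dom}\alpha : (y)\alpha\in\operatorname{dom}\beta\}$. For a natural number $n$, $\mathscr{OI}_n(L)$ is the semigroup, under this composition, of all partial order isomorphisms $\alpha$ of $L$ with $|\operatorname{dom}\alpha|\leq n$. A congruence on a semigroup $S$ is an equivalence relation $\mathfrak{K}$ on $S$ such that $(a,b)\in\mathfrak{K}$ implies $(ca,cb),(ad,bd)\in\mathfrak{K}$ for all $c,d\in S$. A Rees congruence on $S$ is a congruence of the form $\mathfrak{K}_I=(I\times I)\cup\Delta_S$, where $I$ is a (nonempty) two-sided ideal of $S$ and $\Delta_S=\{(s,s):s\in S\}$. *)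

(* Defs.v *)
From HB Require Import structures.
From mathcomp Require Import all_boot all_order.
From mathcomp Require Import monoid.
From mathcomp Require Import boolp classical_sets functions cardinality.

Set Implicit Arguments.
Unset Strict Implicit.
Unset Printing Implicit Defensive.

Import Order.TTheory.
Local Open Scope classical_set_scope.
Local Open Scope card_scope.
Local Open Scope order_scope.

Section Congruences.
Variable S : semigroupType.
Local Open Scope group_scope.

Record is_congruence (K : S -> S -> Prop) : Prop := IsCongruence {
  congr_refl : forall a, K a a;
  congr_sym : forall a b, K a b -> K b a;
  congr_trans : forall a b c, K a b -> K b c -> K a c;
  congr_mull : forall a b c, K a b -> K (c * a) (c * b);
  congr_mulr : forall a b d, K a b -> K (a * d) (b * d) }.

Record is_ideal (I : set S) : Prop := IsIdeal {
  ideal_nonempty : I !=set0;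
  ideal_mull : forall s a, I a -> I (s * a);
  ideal_mulr : forall a s, I a -> I (a * s) }.

Definition rees_rel (I : set S) (a b : S) : Prop := (I a /\ I b) \/ a = b.

Lemma rees_rel_congruence (I : set S) :
  is_ideal I -> is_congruence (rees_rel I).
Proof.
case=> _ Il Ir; split=> [a|a b|a b c|a b c|a b d].
- by right.
- by case=> [[]|->]; [left|right].
- by case=> [[? ?]|->] // [[? ?]|<-]; left.
- by case=> [[? ?]|->]; [left; split; apply: Il|right].
- by case=> [[? ?]|->]; [left; split; apply: Ir|right].
Qed.

Definition is_rees_congruence (K : S -> S -> Prop) : Prop :=
  exists2 I : set S, is_ideal I & forall a b, K a b <-> rees_rel I a b.

End Congruences.

Section PartialOrderIsomorphisms.
Variables (d : Order.disp_t) (L : orderType d).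
Implicit Types f g : L -> option L.

(* A partial map from L to itself is a function f : L -> option L, where
   f x = Some y means that x is in the domain and is sent to y. *)
Definition pdom f : set L := [set x | exists y, f x = Some y].

Definition is_partial_injection f : Prop :=
  forall x1 x2 y, f x1 = Some y -> f x2 = Some y -> x1 = x2.

Definition is_partial_monotone f : Prop :=
  forall x1 x2 y1 y2, f x1 = Some y1 -> f x2 = Some y2 -> x1 <= x2 -> y1 <= y2.

Definition is_partial_order_iso f : Prop :=
  is_partial_injection f /\ is_partial_monotone f.

(* Left-to-right composition: [pcomp g f] applies f first. *)
Definition pmul f g : L -> option L := pcomp g f.

Lemma pmulP f g x z :
  pmul f g x = Some z <-> exists2 y, f x = Some y & g y = Some z.
Proof.
rewrite /pmul /pcomp; case: (f x) => [y|] /=; last by split=> // -[].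
by split=> [gy|[_ [<-]]//]; exists y.
Qed.

Lemma pdom_pmul f g :
  pdom (pmul f g) = [set x | exists2 y, f x = Some y & pdom g y].
Proof.
apply/seteqP; split=> x /=.
  by move=> [z /pmulP[y fx gy]]; exists y => //; exists z.
by move=> [y fx [z gy]]; exists z; apply/pmulP; exists y.
Qed.

Lemma pmulA : associative pmul.
Proof. by move=> f g h; apply/funext => x; rewrite /pmul /pcomp; case: (f x). Qed.

Lemma pmul_order_iso f g : is_partial_order_iso f -> is_partial_order_iso g ->
  is_partial_order_iso (pmul f g).
Proof.
move=> [fi fm] [gi gm]; split=> [x1 x2 z|x1 x2 z1 z2].
  move=> /pmulP[y1 fx1 gy1] /pmulP[y2 fx2 gy2].
  by move: fx1; rewrite (gi _ _ _ gy1 gy2) => fx1; apply: fi fx1 fx2.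
move=> /pmulP[y1 fx1 gy1] /pmulP[y2 fx2 gy2] x12.
exact: gm gy1 gy2 (fm _ _ _ _ fx1 fx2 x12).
Qed.

Lemma card_pdom_pmul n f g : pdom f #<= `I_n -> pdom (pmul f g) #<= `I_n.
Proof.
apply: card_le_trans; apply: subset_card_le; rewrite pdom_pmul.
by move=> x /= [y fx _]; exists y.
Qed.

End PartialOrderIsomorphisms.

Record OI (d : Order.disp_t) (L : orderType d) (n : nat) := MkOI {
  OIfun :> L -> option L;
  OI_order_iso : is_partial_order_iso OIfun;
  OI_rank : pdom OIfun #<= `I_n }.

Section OISemigroup.
Variables (d : Order.disp_t) (L : orderType d) (n : nat).
Implicit Types a b c : OI L n.

Lemma OI_inj a b : OIfun a = OIfun b -> a = b.
Proof.
case: a b => [f fi fr] [g gi gr] /= fg; case: _ / fg gi gr => gi gr.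
by rewrite (Prop_irrelevance fi gi) (Prop_irrelevance fr gr).
Qed.

HB.instance Definition _ := gen_eqMixin (OI L n).
HB.instance Definition _ := gen_choiceMixin (OI L n).

Definition OImul a b : OI L n :=
  MkOI (pmul_order_iso (OI_order_iso a) (OI_order_iso b))
       (card_pdom_pmul b (OI_rank a)).

Lemma OImulA : associative OImul.
Proof. by move=> a b c; apply: OI_inj; rewrite /= pmulA. Qed.

HB.instance Definition _ := isSemigroup.Build (OI L n) OImulA.

End OISemigroup.

(* Main.v *)
Require Import Defs.
From mathcomp Require Import all_boot all_order.
From mathcomp Require Import monoid.
From mathcomp Require Import boolp classical_sets functions cardinality.

(** Any two finite subsets of [L] of the same size are related by exactly one
    order isomorphism, so an element of the semigroup is the same thing as a
    pair of strictly increasing sequences [s], [t] of equal length at most [n]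
    ([OI_chart]); its rank is that length.  Two consequences carry the proof.
    If [g] maps a part of [s] into [t] and has the rank of the isomorphism
    [f] from [s] onto [t], then [g = f].  And if [a] has rank at least that of
    [f], then [f = u * a * v] for suitable [u] and [v]: let [u] carry the
    domain of [f] onto a set [D] of points of the domain of [a], and let [v]
    carry the image of [D] onto the range of [f].

    Let [K] be a congruence, [K a b] with [a <> b], and say that the rank [k]
    of [a] is at least that of [b].  Then [a] and [b] differ at some point [x]
    of the domain of [a].  By induction on the rank, every [f] of rank at most
    [k] is [K]-related to the empty map ([congr_collapse]): write
    [f = u * a * v] as above with [x] in [D].  The element [g = u * b * v] is
    related to [f], maps a part of the domain of [f] into its range, and
    differs from [f] at the point that [u] sends to [x]; hence its rank is
    smaller, and the induction hypothesis applies to it.  In particular [a] and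
    [b] lie in the ideal of elements related to the empty map, so [K] is the
    Rees congruence of this ideal. *)

Set Implicit Arguments.
Unset Strict Implicit.
Unset Printing Implicit Defensive.

Import Order.TTheory.
Local Open Scope order_scope.

(** * Strictly increasing sequences *)

Section SortedSequences.
Variables (d : Order.disp_t) (L : orderType d).
Implicit Types (s t : seq L) (x : L).

Lemma lt_sorted_sub_eq s t : sorted <%O s -> sorted <%O t ->
  {subset s <= t} -> (size t <= size s)%N -> s = t.
Proof.
move=> ss st sub le_ts; apply: lt_sorted_eq => //.
by have [] := uniq_min_size (lt_sorted_uniq ss) sub le_ts.
Qed.

Lemma lt_sorted_select s x m : sorted <%O s -> x \in s -> (m < size s)%N ->
  exists D, [/\ sorted <%O D, size D = m.+1, x \in D & {subset D <= s}].
Proof.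
move=> ss xs ms; have us := lt_sorted_uniq ss.
exists (sort <=%O (x :: take m (rem x s))); split.
- rewrite sort_lt_sorted /= take_uniq ?rem_uniq // andbT.
  by apply/negP => /mem_take; rewrite mem_rem_uniq // inE eqxx.
- rewrite size_sort /= size_takel // size_rem //.
  by case: (size s) ms.
- by rewrite mem_sort mem_head.
- by move=> y; rewrite mem_sort inE => /predU1P[->//|/mem_take/mem_rem].
Qed.

End SortedSequences.

(** * Partial maps given by pairs of sequences *)

Section Charts.
Variables (d : Order.disp_t) (L : orderType d).
Implicit Types (s t r : seq L) (x y : L).

(** The partial map sending the i-th entry of [s] to the i-th entry of [t]; for
    increasing sequences of equal length it is the unique order isomorphism
    between the sets of their entries. *)
Definition seqmap s t x : option L :=
  if x \in s then Some (nth x t (index x s)) else None.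

Lemma seqmap_mem s t x y : size s = size t -> seqmap s t x = Some y ->
  x \in s /\ y \in t.
Proof.
move=> est; rewrite /seqmap; case: ifP => // xs [<-]; split=> //.
by rewrite mem_nth // -est index_mem.
Qed.

Lemma seqmap_comp s t r : uniq t -> size s = size t -> size t = size r ->
  pmul (seqmap s t) (seqmap t r) = seqmap s r.
Proof.
move=> ut est etr; apply/funext => x; rewrite /pmul /pcomp /seqmap.
case: ifP => //= xs; have lti : (index x s < size t)%N by rewrite -est index_mem.
by rewrite mem_nth // index_uniq // (set_nth_default x) // -etr.
Qed.

Lemma seqmap_onto s t y : uniq s -> size s = size t -> y \in t ->
  exists2 x, x \in s & seqmap s t x = Some y.
Proof.
move=> us est yt; have lti : (index y t < size s)%N by rewrite est index_mem.
exists (nth y s (index y t)); first exact: mem_nth.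
by rewrite /seqmap mem_nth // index_uniq // (set_nth_default y) -?est // nth_index.
Qed.

Lemma seqmap_id s x : x \in s -> seqmap s s x = Some x.
Proof. by move=> xs; rewrite /seqmap xs nth_index. Qed.

Lemma seqmap_order_iso s t : sorted <%O s -> sorted <%O t -> size s = size t ->
  is_partial_order_iso (seqmap s t).
Proof.
move=> ss st est; split=> [x1 x2 y|x1 x2 y1 y2]; rewrite /seqmap.
  case: ifP => // x1s [<-]; case: ifP => // x2s [].
  have lt1 : (index x1 s < size t)%N by rewrite -est index_mem.
  have lt2 : (index x2 s < size t)%N by rewrite -est index_mem.
  rewrite (set_nth_default x1) // => /eqP.
  rewrite nth_uniq ?lt_sorted_uniq // => /eqP e.
  by rewrite -[x1](nth_index x1 x1s) -e nth_index.
case: ifP => // x1s [<-]; case: ifP => // x2s [<-].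
have lt1 : (index x1 s < size t)%N by rewrite -est index_mem.
have lt2 : (index x2 s < size t)%N by rewrite -est index_mem.
rewrite (set_nth_default x1 x2) // lt_sorted_leq_nth //.
rewrite -{1}[x1](nth_index x1 x1s) -{1}[x2](nth_index x1 x2s).
by rewrite lt_sorted_leq_nth // inE -?est index_mem.
Qed.

Lemma card_pdom_seqmap n s t : (size s <= n)%N ->
  (pdom (seqmap s t) #<= `I_n)%card.
Proof.
case: s => [|x0 s'] le_sn.
  by rewrite (_ : pdom _ = set0) ?card_ge0 // -subset0 => x [].
set s := x0 :: s' in le_sn *.
have sub : (pdom (seqmap s t) `<=` nth x0 s @` `I_n)%classic.
  move=> x [y]; rewrite /seqmap; case: ifP => // xs _.
  exists (index x s); last exact: nth_index.
  by apply: leq_trans le_sn; rewrite index_mem.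
exact: card_le_trans (subset_card_le sub) (card_image_le _ _).
Qed.

End Charts.

(** * Rank and uniqueness of order isomorphisms *)

Section Rank.
Variables (d : Order.disp_t) (L : orderType d) (n : nat).
Implicit Types (a b f g : OI L n) (s t : seq L).

Definition chart f s t :=
  [/\ sorted <%O s, sorted <%O t, size s = size t & OIfun f = seqmap s t].

Lemma chart_exists s t : sorted <%O s -> sorted <%O t -> size s = size t ->
  (size s <= n)%N -> exists f, chart f s t.
Proof.
move=> ss st est le_sn.
by exists (MkOI (seqmap_order_iso ss st est) (card_pdom_seqmap t le_sn)).
Qed.

Lemma chart_uniq f g s t : chart f s t -> chart g s t -> f = g.
Proof. by move=> [_ _ _ ef] [_ _ _ eg]; apply: OI_inj; rewrite ef eg. Qed.

(** List the finite domain of [f] in increasing order as [s]; the values of [f]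
    along [s] increase strictly because [f] is monotone and injective. *)
Lemma OI_chart f : exists s t, chart f s t /\ (size s <= n)%N.
Proof.
have [fi fm] := OI_order_iso f; have fn := OI_rank f.
have fin : finite_set (pdom f) by apply: card_le_finite fn (finite_II n).
set e := finmap.enum_fset (fset_set (pdom f)).
pose s := sort <=%O e.
have mem_s x : x \in s = (f x != None).
  rewrite mem_sort; apply/idP/idP.
    by rewrite in_fset_set // inE => -[y ->].
  by rewrite in_fset_set // inE => /=; case E: (f x) => [y|//] _; exists y.
have ss : sorted <%O s by rewrite sort_lt_sorted finmap.fset_uniq.
exists s, [seq odflt x (f x) | x <- s]; split; last first.
  by rewrite size_sort; apply: geq_card_fset_set fn.
split=> //; last 1 first.
- apply/funext => x; rewrite /seqmap.
  case: ifPn => xs; last by move: xs; rewrite mem_s negbK => /eqP.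
  rewrite (nth_map x) ?index_mem // nth_index //.
  by move: xs; rewrite mem_s; case: (f x).
- rewrite sorted_map; apply: sub_in_sorted (allss s) ss => x y.
  rewrite !mem_s /=; case Ex: (f x) => [x'|//] _; case Ey: (f y) => [y'|//] _ /= xy.
  rewrite lt_neqAle (fm _ _ _ _ Ex Ey (ltW xy)) andbT.
  apply/eqP => e'; move: Ey; rewrite -e' => Ey.
  by rewrite (fi _ _ _ Ex Ey) ltxx in xy.
- by rewrite size_map.
Qed.

Lemma chart_mem f s t x y : chart f s t -> f x = Some y -> x \in s /\ y \in t.
Proof. by move=> [_ _ est ->]; apply: seqmap_mem. Qed.

Lemma chart_mul f g s t r : chart f s t -> chart g t r -> chart (f * g)%g s r.
Proof.
move=> [ss st est ef] [_ sr etr eg]; split=> //; first by rewrite est.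
by rewrite /= ef eg seqmap_comp // lt_sorted_uniq.
Qed.

(** The chart [s', t'] of [g] consists of subsequences of [s] and [t], and
    these are all of [s] and [t] if the lengths agree. *)
Lemma chart_full f g s t s' t' : chart f s t -> chart g s' t' ->
  (forall x y, g x = Some y -> x \in s /\ y \in t) ->
  (size s <= size s')%N -> g = f.
Proof.
move=> cf cg; have [ss st est _] := cf; have [ss' st' est' eg] := cg.
rewrite eg => sub le_ss'.
have es : s' = s.
  apply: lt_sorted_sub_eq => // x xs'.
  have gx : seqmap s' t' x = Some (nth x t' (index x s')) by rewrite /seqmap xs'.
  by have [] := sub _ _ gx.
have et : t' = t.
  apply: lt_sorted_sub_eq => // [y yt'|]; last by rewrite -est -est'.
  have [x _ gx] := seqmap_onto (lt_sorted_uniq ss') est' yt'.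
  by have [] := sub _ _ gx.
by apply: (@chart_uniq _ _ s t); rewrite // -es -et.
Qed.

(** If [b] took the values of [a] on all of [p], its domain would contain [p]
    and, being no larger, would equal it. *)
Lemma chart_neq_point a b p q p' q' : chart a p q -> chart b p' q' ->
  (size p' <= size p)%N -> a <> b -> exists2 x, x \in p & a x <> b x.
Proof.
move=> ca cb le_p ab; apply: contrapT => nex; apply: ab; apply: OI_inj.
have [sp _ epq ea] := ca; have [sp' _ _ eb] := cb.
have eab x : x \in p -> a x = b x.
  by move=> xp; apply: contrapT => nab; apply: nex; exists x.
have ep : p = p'.
  apply: lt_sorted_sub_eq => // x xp.
  have := eab x xp; rewrite {1}ea {1}/seqmap xp => /esym.
  by move=> /(chart_mem cb)[].
apply/funext => x; case: (boolP (x \in p)) => [/eab//|xp].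
by rewrite ea eb /seqmap -ep (negPf xp).
Qed.

(** Since [a] is defined on all of [D], restricting it to [D] by the idempotent
    [i] yields an element whose domain is exactly [D]. *)
Lemma chart_restrict a p q D i : chart a p q -> {subset D <= p} ->
  chart i D D -> exists D', chart (i * a)%g D D'.
Proof.
move=> ca sub ci; have [sp sq epq ea] := ca; have [sD _ _ ei] := ci.
have [s [t [cia _]]] := OI_chart (i * a)%g.
have [ss st est eia] := cia.
have eD : s = D.
  apply: lt_sorted_eq => // x; apply/idP/idP => xs.
    have : (i * a)%g x = Some (nth x t (index x s)) by rewrite eia /seqmap xs.
    by move=> /pmulP[y /(chart_mem ci)[]].
  have : (i * a)%g x = Some (nth x q (index x p)).
    apply/pmulP; exists x; first by rewrite ei seqmap_id.
    by rewrite ea /seqmap sub.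
  by move=> /(chart_mem cia)[].
by exists t; rewrite -{1}eD.
Qed.

Definition OI0 : OI L n :=
  MkOI (@seqmap_order_iso _ L [::] [::] isT isT erefl)
       (@card_pdom_seqmap _ L n [::] [::] isT).

Lemma OI0_mul f : (OI0 * f)%g = OI0.
Proof. exact: OI_inj. Qed.

Lemma OI_mul0 f : (f * OI0)%g = OI0.
Proof.
by apply: OI_inj; apply/funext => x; rewrite /= /pmul /pcomp; case: (f x).
Qed.

Lemma chart_size0 f s t : chart f s t -> size s = 0%N -> f = OI0.
Proof.
by move=> [_ _ _ ef] /size0nil es; apply: OI_inj; rewrite ef es.
Qed.

End Rank.

(** * Collapse of low ranks under a congruence *)

Section Congruence.
Variables (d : Order.disp_t) (L : orderType d) (n : nat).
Variable K : OI L n -> OI L n -> Prop.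
Hypothesis congK : is_congruence K.
Implicit Types (a b f g : OI L n).

(** Induction on the rank of [f], through [f = u * (i * a) * v] where [i] is
    the identity of a set [D] of points of the domain of [a], as many as the
    rank of [f] and including a point [x] at which [a] and [b] differ.
    Replacing [a] by [b] lowers the rank: at equal rank, uniqueness of the
    order isomorphism would give [f] back and force [a x = b x]. *)
Lemma congr_collapse a b p q p' q' : chart a p q -> chart b p' q' ->
  (size p <= n)%N -> (size p' <= size p)%N -> K a b -> a <> b ->
  forall f s t, chart f s t -> (size s <= size p)%N -> K f (OI0 L n).
Proof.
move=> ca cb le_pn le_p Kab nab f s t.
have [x xp nabx] := chart_neq_point ca cb le_p nab.
have [m] := ubnP (size s); elim: m f s t => // m IH f s t le_sm cf le_sp.
have [sp _ _ _] := ca; have [ss st est ef] := cf.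
have [s0|s_gt0] := posnP (size s).
  by rewrite (chart_size0 cf s0); exact: congr_refl.
have le_sn := leq_trans le_sp le_pn.
have [|D [sD eD xD subD]] := lt_sorted_select (m := (size s).-1) sp xp.
  by rewrite prednK.
rewrite prednK // in eD.
have [i ci] : exists i : OI L n, chart i D D.
  by apply: chart_exists => //; rewrite eD.
have [D' cia] := chart_restrict ca subD ci; have [_ sD' eD' _] := cia.
have [u cu] : exists u : OI L n, chart u s D by apply: chart_exists.
have [v cv] : exists v : OI L n, chart v D' t.
  by apply: chart_exists; rewrite -?eD' ?eD.
have fE : f = (u * (i * a) * v)%g.
  exact: chart_uniq cf (chart_mul (chart_mul cu cia) cv).
set g := (u * (i * b) * v)%g.
have Kfg : K f g.
  by rewrite fE; apply: congr_mulr => //; do 2 apply: congr_mull => //.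
have [y ys uy] : exists2 y, y \in s & u y = Some x.
  have [_ _ esD eu] := cu.
  by rewrite eu; apply: seqmap_onto => //; exact: lt_sorted_uniq.
have ix : i x = Some x by have [_ _ _ ->] := ci; rewrite seqmap_id.
have ngf : g <> f.
  (* [f y] is defined and equals the value of [v] at [a x]; if [g y] were the
     same, then injectivity of [v] would give [b x = a x]. *)
  move=> egf; apply: nabx.
  have fy : f y = Some (nth y t (index y s)) by rewrite ef /seqmap ys.
  have gy := fy; rewrite -egf in gy; rewrite fE in fy.
  move: fy => /pmulP[w /pmulP[x1]]; rewrite uy => -[<-] /pmulP[x2].
  rewrite ix => -[<-] aw vw.
  move: gy => /pmulP[w' /pmulP[x3]]; rewrite uy => -[<-] /pmulP[x4].
  rewrite ix => -[<-] bw' vw'.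
  by have [vi _] := OI_order_iso v; rewrite aw bw' (vi _ _ _ vw vw').
have [s' [t' [cg _]]] := OI_chart g.
have lt_s's : (size s' < size s)%N.
  rewrite ltnNge; apply/negP => le_ss'; apply: ngf.
  apply: (chart_full cf cg) le_ss' => z w.
  move=> /pmulP[w1 /pmulP[z1 /(chart_mem cu)[zs _] _]].
  by move=> /(chart_mem cv)[_ wt].
apply: congr_trans Kfg _ => //; apply: IH cg _.
- exact: leq_trans lt_s's _.
- exact: leq_trans (ltnW lt_s's) le_sp.
Qed.

Lemma congr_neq_collapse a b : K a b -> a <> b ->
  K a (OI0 L n) /\ K b (OI0 L n).
Proof.
move=> Kab nab.
have [p [q [ca le_pn]]] := OI_chart a; have [p' [q' [cb le_p'n]]] := OI_chart b.
have [le|/ltnW le] := leqP (size p') (size p).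
- have H := congr_collapse ca cb le_pn le Kab nab.
  by split; [exact: H ca _|exact: H cb _].
- have Kba := congr_sym congK Kab.
  have H := congr_collapse cb ca le_p'n le Kba (nesym nab).
  by split; [exact: H ca _|exact: H cb _].
Qed.

Lemma congr_zero_ideal : is_ideal [set a | K a (OI0 L n)]%classic.
Proof.
split=> [|s a|a s] /=; first by exists (OI0 L n); exact: congr_refl.
- by move=> /(congr_mull congK s); rewrite OI_mul0.
- by move=> /(congr_mulr congK s); rewrite OI0_mul.
Qed.

End Congruence.

Theorem mainTheorem3 (d : Order.disp_t) (L : orderType d) (n : nat)
    (L_infinite : infinite_set [set: L]%classic) (n_gt0 : (0 < n)%N)
    (K : OI L n -> OI L n -> Prop) :
  is_congruence K -> is_rees_congruence K.
Proof.
move=> congK; exists [set a | K a (OI0 L n)]%classic.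
  exact: congr_zero_ideal.
move=> a b; split=> [Kab|[[Ka0 Kb0]|->]].
- have [->|nab] := pselect (a = b); first by right.
  by left; exact: congr_neq_collapse.
- by apply: congr_trans Ka0 _ => //; exact: congr_sym.
- exact: congr_refl.
Qed.
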